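(* For a positive integer $n$, $$\left\lfloor \zeta_n^*(3)^{-1}\right\rfloor=\begin{cases}-\left(2n^3-3n^2+\frac{9}{2}n-\frac{5}{2}\right)-\frac{3}{2} & \text{if } n\geq 22 \text{ is even},\\ 2n^3-3n^2+\frac{9}{2}n-\frac{5}{2} & \text{if } n\geq 7 \text{ is odd}.\end{cases}$$
   Context: For a positive integer $n$ and $s$ with $\Re(s)>0$, $\zeta_n^*(s)=\sum_{k=n}^{\infty}\frac{(-1)^{k+1}}{k^s}$ is the tail of the alternating Riemann zeta function. $\lfloor x\rfloor$ denotes the largest integer less than or equal to the real number $x$. *)

(* Defs.v *)
From Stdlib Require Import Reals.
From Coquelicot Require Import Coquelicot.

Open Scope R_scope.

(* The tail [sum_{k >= n} (-1)^(k+1) / k^s], for [n >= 1] and a real exponent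
   [s > 0], reindexed by [k = n + j] because [Series] starts at 0.  [Series] is
   the limit of the partial sums, so conditional convergence ([s <= 1]) is
   covered. *)
Definition zeta_star (n : nat) (s : R) : R :=
  Series (fun j : nat => (-1) ^ (n + j + 1) / Rpower (INR (n + j)) s).

(* Main.v *)
Require Import Defs.
From Stdlib Require Import Reals.
From Coquelicot Require Import Coquelicot.
From Stdlib Require Import Lra Lia.

Open Scope R_scope.

(** With [x = n - 1/2] and [A = |zeta_star n 3|], one has
    [1 / A = 2 x^3 + 3 x - (39/8) / x + O(1 / x^3)], and the truncations of this
    expansion enclose [1 / A].  Indeed [A] is the sum over [k = n, n+2, ...] of
    [1/k^3 - 1/(k+1)^3], and each such term lies between [1/F x - 1/F (x+2)]
    ([x = k - 1/2]) for the two truncations [F], so both bounds telescope.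
    Finally [2 x^3 + 3 x] is [3/4] above the cubic polynomial of the theorem. *)

(** The partial sums of even length telescope to at most [g 0 - g (S m)]. Since the series
    converges, its sum is already the limit along this subsequence. *)
Lemma series_le_of_pairs_telescope (a g : nat -> R) (l : R) :
  is_series a l ->
  (forall m, a (2 * m)%nat + a (2 * m + 1)%nat <= g m - g (S m)) ->
  is_lim_seq g 0 ->
  l <= g 0%nat.
Proof.
  intros Ha Hp Hg.
  assert (Hs : forall m, sum_n a (2 * m + 1) <= g 0%nat - g (S m)).
  { induction m as [|m IH].
    - specialize (Hp 0%nat). simpl in *. rewrite sum_Sn, sum_O.
      unfold plus; simpl. lra.
    - replace (2 * S m + 1)%nat with (S (S (2 * m + 1))) by lia.
      rewrite 2!sum_Sn. specialize (Hp (S m)).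
      replace (S (2 * m + 1)) with (2 * S m)%nat by lia.
      replace (S (2 * S m)) with (2 * S m + 1)%nat by lia.
      unfold plus; simpl in *. lra. }
  assert (H1 : is_lim_seq (fun m => sum_n a (2 * m + 1)) l).
  { apply (is_lim_seq_subseq (sum_n a) l (fun m => (2 * m + 1)%nat)).
    - apply eventually_subseq. intros; lia.
    - exact Ha. }
  assert (H2 : is_lim_seq (fun m => g 0%nat - g (S m)) (g 0%nat - 0)).
  { apply is_lim_seq_minus'.
    - apply is_lim_seq_const.
    - apply is_lim_seq_incr_1 in Hg. exact Hg. }
  pose proof (is_lim_seq_le _ _ _ _ Hs H1 H2) as H. simpl in H. lra.
Qed.

Lemma is_lim_seq_inv_ge_INR (u : nat -> R) :
  (forall m, INR m <= u m) -> is_lim_seq (fun m => / u m) 0.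
Proof.
  intros Hu.
  apply (is_lim_seq_inv u p_infty); [|discriminate].
  apply (is_lim_seq_le_p_loc INR).
  - exists 0%nat. intros; apply Hu.
  - apply is_lim_seq_INR.
Qed.

Lemma ex_series_alternating_cubes (n : nat) :
  (0 < n)%nat -> ex_series (fun j => (-1) ^ j * / INR (n + j) ^ 3).
Proof.
  intros Hn.
  assert (Hpos : forall j, 1 <= INR (n + j)).
  { intros j. apply (le_INR 1). lia. }
  destruct (alternated_series (fun j => / INR (n + j) ^ 3)) as [l Hl].
  - intros j. apply Rinv_le_contravar.
    + apply pow_lt. specialize (Hpos j). lra.
    + apply pow_incr. split; [apply pos_INR|apply le_INR; lia].
  - apply is_lim_seq_Reals, is_lim_seq_inv_ge_INR. intros j.
    assert (INR j <= INR (n + j)) by (apply le_INR; lia).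
    specialize (Hpos j). nra.
  - exists l. apply is_series_Reals. exact Hl.
Qed.

(** The tail with its sign normalised so that the first term is positive; this is the $A$ of the
    overview. *)
Definition alternating_tail (n : nat) : R :=
  Series (fun j => (-1) ^ j * / INR (n + j) ^ 3).

Lemma zeta_star_3 (n : nat) :
  (0 < n)%nat -> zeta_star n 3 = (-1) ^ (n + 1) * alternating_tail n.
Proof.
  intros Hn. unfold zeta_star, alternating_tail.
  rewrite <- Series_scal_l. apply Series_ext. intros j.
  replace 3 with (INR 3) at 1 by (simpl; lra).
  rewrite Rpower_pow by (apply lt_0_INR; lia).
  replace (n + j + 1)%nat with (n + 1 + j)%nat by lia.
  rewrite (pow_add (-1) (n + 1) j). unfold Rdiv. ring.
Qed.

(** Upper and lower refer to $1/A$; for $A$ itself the roles are exchanged. *)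
Definition upper_approx (x : R) : R := 2 * x ^ 3 + 3 * x.
Definition lower_approx (x : R) : R := 2 * x ^ 3 + 3 * x - 39 / 8 / x.

(** Serves twice: it makes both truncations positive, and it forces their reciprocals to tend to
    0. *)
Lemma approx_ge_id (x : R) :
  13 / 2 <= x -> x <= lower_approx x /\ x <= upper_approx x.
Proof.
  intros Hx. unfold lower_approx, upper_approx.
  assert (0 < / x <= 1).
  { split; [apply Rinv_0_lt_compat; lra|].
    rewrite <- Rinv_1. apply Rinv_le_contravar; lra. }
  assert (0 < x ^ 3) by (apply pow_lt; lra).
  split; unfold Rdiv; nra.
Qed.

(** The difference of the two sides is a rational function with positive denominator. Its numerator,
    expanded in $t = x - 13/2 \ge 0$, has only positive coefficients. The base point $13/2$
    corresponds to $n = 7$. *)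
Lemma upper_approx_step (x : R) : 13 / 2 <= x ->
  / upper_approx x - / upper_approx (x + 2)
  <= / (x + 1 / 2) ^ 3 - / (x + 3 / 2) ^ 3.
Proof.
  intros Hx. apply Rminus_le_0.
  pose (t := x - 13 / 2).
  assert (Ht : 0 <= t) by (unfold t; lra).
  replace (_ - _) with
    ((3390765 / 16 + 1825605 / 16 * t + 367407 / 16 * t ^ 2
      + 4095 / 2 * t ^ 3 + 273 / 4 * t ^ 4)
     / ((x + 1 / 2) ^ 3 * (x + 3 / 2) ^ 3
        * (x * (2 * x ^ 2 + 3)) * ((x + 2) * (2 * (x + 2) ^ 2 + 3)))).
  - apply Rdiv_le_0_compat.
    + pose proof (pow_le t 2 Ht). pose proof (pow_le t 3 Ht).
      pose proof (pow_le t 4 Ht). lra.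
    + repeat apply Rmult_lt_0_compat; try apply pow_lt; nra.
  - unfold upper_approx, t. field. repeat split; nra.
Qed.

Lemma lower_approx_step (x : R) : 13 / 2 <= x ->
  / (x + 1 / 2) ^ 3 - / (x + 3 / 2) ^ 3
  <= / lower_approx x - / lower_approx (x + 2).
Proof.
  intros Hx. apply Rminus_le_0.
  pose (t := x - 13 / 2).
  assert (Ht : 0 <= t) by (unfold t; lra).
  assert (HD : forall y, 13 / 2 <= y -> 0 < 2 * y ^ 4 + 3 * y ^ 2 - 39 / 8).
  { intros y Hy. pose proof (pow_le y 4). nra. }
  (* Clearing the inner fraction leaves polynomial denominators, positive by [HD], so the expansion
     in [t] works as for the upper truncation. *)
  assert (HF : forall y, 13 / 2 <= y ->
    / lower_approx y = y / (2 * y ^ 4 + 3 * y ^ 2 - 39 / 8)).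
  { intros y Hy. specialize (HD y Hy).
    replace (lower_approx y) with ((2 * y ^ 4 + 3 * y ^ 2 - 39 / 8) / y)
      by (unfold lower_approx; field; lra).
    field. split; lra. }
  rewrite 2!HF by lra.
  pose proof (HD x Hx) as H1. assert (H2 := HD (x + 2) ltac:(lra)).
  replace (_ - _) with
    ((1825200 + 972720 * t + 194448 * t ^ 2 + 17280 * t ^ 3 + 576 * t ^ 4)
     / ((x + 1 / 2) ^ 3 * (x + 3 / 2) ^ 3
        * (2 * x ^ 4 + 3 * x ^ 2 - 39 / 8)
        * (2 * (x + 2) ^ 4 + 3 * (x + 2) ^ 2 - 39 / 8))).
  - apply Rdiv_le_0_compat.
    + pose proof (pow_le t 2 Ht). pose proof (pow_le t 3 Ht).
      pose proof (pow_le t 4 Ht). lra.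
    + repeat apply Rmult_lt_0_compat; try apply pow_lt; lra.
  - unfold t. field. repeat split; lra.
Qed.

Lemma alternating_tail_bounds (n : nat) : (7 <= n)%nat ->
  / upper_approx (INR n - 1 / 2) <= alternating_tail n
  <= / lower_approx (INR n - 1 / 2).
Proof.
  intros Hn.
  (* The point $k - 1/2$ for the pair starting at $k = n + 2m$. *)
  pose (x := fun m => INR n - 1 / 2 + 2 * INR m).
  assert (Hn' : 7 <= INR n).
  { replace 7 with (INR 7) by (simpl; lra). apply le_INR, Hn. }
  assert (Hx : forall m, 13 / 2 <= x m /\ INR m <= x m).
  { intros m. pose proof (pos_INR m). unfold x. lra. }
  assert (HxS : forall m, x (S m) = x m + 2).
  { intros m. unfold x. rewrite S_INR. ring. }
  assert (Ha : is_series (fun j => (-1) ^ j * / INR (n + j) ^ 3)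
                 (alternating_tail n)).
  { apply Series_correct, ex_series_alternating_cubes. lia. }
  assert (Hpair : forall m,
    (-1) ^ (2 * m) * / INR (n + 2 * m) ^ 3
    + (-1) ^ (2 * m + 1) * / INR (n + (2 * m + 1)) ^ 3
    = / (x m + 1 / 2) ^ 3 - / (x m + 3 / 2) ^ 3).
  { intros m. rewrite pow_add, pow_1_even, !plus_INR, mult_INR.
    replace (INR n + INR 2 * INR m) with (x m + 1 / 2)
      by (unfold x; simpl INR; lra).
    replace (INR n + (INR 2 * INR m + INR 1)) with (x m + 3 / 2)
      by (unfold x; simpl INR; lra).
    ring. }
  assert (HlimU : is_lim_seq (fun m => / upper_approx (x m)) 0).
  { apply is_lim_seq_inv_ge_INR. intros m. destruct (Hx m) as [H1 H2].
    destruct (approx_ge_id _ H1). lra. }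
  assert (HlimL : is_lim_seq (fun m => / lower_approx (x m)) 0).
  { apply is_lim_seq_inv_ge_INR. intros m. destruct (Hx m) as [H1 H2].
    destruct (approx_ge_id _ H1). lra. }
  replace (INR n - 1 / 2) with (x 0%nat) by (unfold x; simpl; lra).
  split.
  (* The telescoping lemma only bounds from above, so it is applied to the negated series. *)
  - apply Ropp_le_cancel.
    apply (series_le_of_pairs_telescope
             (fun j => - ((-1) ^ j * / INR (n + j) ^ 3))
             (fun m => - / upper_approx (x m))).
    + apply (is_series_opp _ _ Ha).
    + intros m. rewrite HxS. specialize (Hpair m).
      pose proof (upper_approx_step (x m) (proj1 (Hx m))). lra.
    + rewrite <- Ropp_0. apply (is_lim_seq_opp _ 0), HlimU.
  - apply (series_le_of_pairs_telescope _ (fun m => / lower_approx (x m)) _ Ha).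
    + intros m. rewrite HxS. specialize (Hpair m).
      pose proof (lower_approx_step (x m) (proj1 (Hx m))). lra.
    + exact HlimL.
Qed.

Lemma inv_alternating_tail_bounds (n : nat) : (7 <= n)%nat ->
  lower_approx (INR n - 1 / 2) <= / alternating_tail n
  <= upper_approx (INR n - 1 / 2).
Proof.
  intros Hn. destruct (alternating_tail_bounds n Hn) as [H1 H2].
  assert (Hn' : 7 <= INR n).
  { replace 7 with (INR 7) by (simpl; lra). apply le_INR, Hn. }
  destruct (approx_ge_id (INR n - 1 / 2)) as [HL HU]; [lra|].
  assert (0 < / upper_approx (INR n - 1 / 2)) by (apply Rinv_0_lt_compat; lra).
  split.
  - rewrite <- (Rinv_inv (lower_approx _)).
    apply Rinv_le_contravar; lra.
  - rewrite <- (Rinv_inv (upper_approx _)).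
    apply Rinv_le_contravar; lra.
Qed.

Theorem theorem1p3 (n : nat) (hn : (0 < n)%nat) :
  ((22 <= n)%nat -> Nat.Even n ->
     IZR (Zfloor (/ zeta_star n 3)) =
       - (2 * INR n ^ 3 - 3 * INR n ^ 2 + 9 / 2 * INR n - 5 / 2) - 3 / 2) /\
  ((7 <= n)%nat -> Nat.Odd n ->
     IZR (Zfloor (/ zeta_star n 3)) =
       2 * INR n ^ 3 - 3 * INR n ^ 2 + 9 / 2 * INR n - 5 / 2).
Proof.
  rewrite zeta_star_3 by exact hn.
  split; intros Hn [k Hk].
  - destruct (inv_alternating_tail_bounds n) as [HL HU]; [lia|].
    assert (Hn' : 22 <= INR n).
    { replace 22 with (INR 22) by (simpl; lra). apply le_INR, Hn. }
    (* With $P$ the cubic, $-1/A$ lies between $-P - 3/4$ and $-P - 3/4 + \frac{39/8}{n - 1/2}$, and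
       must stay strictly below $-P - 1/2$. At $n = 20$ the correction equals $1/4$, so 22 is the
       first even $n$ that qualifies. *)
    assert (Hinv : 39 / 8 / (INR n - 1 / 2) < 1 / 4).
    { apply Rlt_div_l; lra. }
    unfold lower_approx, upper_approx in *.
    (* Only the [n] in the exponent of the sign is replaced. *)
    rewrite Hk at 1. rewrite pow_add, pow_1_even.
    replace (/ (1 * (-1) ^ 1 * alternating_tail n))
      with (- / alternating_tail n)
      by (rewrite <- Rinv_opp; f_equal; ring).
    pose (K := Z.of_nat k).
    (* For even $n$ the cubic is a half-integer; subtracting $3/2$ from its negative gives this
       integer. *)
    assert (HK : IZR (- (16 * K * K * K - 12 * K * K + 9 * K) + 1) =
      - (2 * INR n ^ 3 - 3 * INR n ^ 2 + 9 / 2 * INR n - 5 / 2) - 3 / 2).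
    { rewrite Hk, mult_INR, (INR_IZR_INZ k). fold K. simpl INR.
      rewrite plus_IZR, opp_IZR, plus_IZR, minus_IZR, !mult_IZR. field. }
    rewrite <- HK. f_equal. apply Zfloor_eq. rewrite HK. nra.
  - destruct (inv_alternating_tail_bounds n Hn) as [HL HU].
    assert (Hn' : 7 <= INR n).
    { replace 7 with (INR 7) by (simpl; lra). apply le_INR, Hn. }
    (* Here $1/A \ge P$ is required, so the correction may use up the whole gap $3/4$; equality
       occurs at $n = 7$. *)
    assert (Hinv : 39 / 8 / (INR n - 1 / 2) <= 3 / 4).
    { apply Rle_div_l; lra. }
    unfold lower_approx, upper_approx in *.
    replace ((-1) ^ (n + 1)) with 1
      by (replace (n + 1)%nat with (2 * (k + 1))%nat by lia;
          now rewrite pow_1_even).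
    rewrite Rmult_1_l.
    pose (K := Z.of_nat k).
    assert (HK : IZR (16 * K * K * K + 12 * K * K + 9 * K + 1) =
      2 * INR n ^ 3 - 3 * INR n ^ 2 + 9 / 2 * INR n - 5 / 2).
    { rewrite Hk, plus_INR, mult_INR, (INR_IZR_INZ k). fold K. simpl INR.
      rewrite !plus_IZR, !mult_IZR. field. }
    rewrite <- HK. f_equal. apply Zfloor_eq. rewrite HK. nra.
Qed.
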